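(* Let $\Pi\colon D\to Z$ and $\widetilde\Pi\colon\widetilde D\to\widetilde Z$ be vector bundles and let $\Delta=(\delta,\zeta)$ be a morphism of vector bundles from $\Pi$ to $\widetilde\Pi$, with $\delta\colon D\to\widetilde D$ and $\zeta\colon Z\to\widetilde Z$. If the mapping $\delta\colon D\to\widetilde D$ is a fiberwise isomorphism, then for every connection map $\widetilde K\colon T\widetilde D\to\widetilde D$ on the vector bundle $\widetilde\Pi$ there exists a unique connection map $K\colon TD\to D$ on the vector bundle $\Pi$ such that $\delta\circ K=\widetilde K\circ T\delta$.
   Context: Manifolds are smooth (Fréchet differentiable) Banach manifolds and vector bundles are smooth, locally trivial bundles whose fibers are Banach spaces; $\tau_D\colon TD\to D$ is the tangent bundle. Fiberwise isomorphism means that $\delta$ restricts to a topological linear isomorphism from each fiber $D_z=\Pi^{-1}(z)$ onto $\widetilde D_{\zeta(z)}$. A connection map (connector) on a vector bundle $\Pi\colon D\to Z$ is a smooth mapping $K\colon TD\to D$ such that: (i) $\Pi\circ K=\Pi\circ\tau_D$ and the pair $(K,\Pi)$ is a morphism of vector bundles from $\tau_D\colon TD\to D$ to $\Pi\colon D\to Z$; (ii) $K(\varepsilon(\xi,\eta))=\eta$ for all $(\xi,\eta)\in D\times_Z D=\{(\xi,\eta)\in D\times D\mid\Pi(\xi)=\Pi(\eta)\}$, where $\varepsilon(\xi,\eta)\in T_\xi D$ is the velocity at $t=0$ of the path $t\mapsto\xi+t\eta$. *)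

(* Defs.v *)
From HB Require Import structures.
From mathcomp Require Import all_boot all_order all_algebra.
From mathcomp Require Import all_classical all_reals topology normedtype landau derive.

Set Implicit Arguments.
Unset Strict Implicit.
Unset Printing Implicit Defensive.

Import Order.TTheory GRing.Theory Num.Theory.
Import numFieldNormedType.Exports.

Local Open Scope classical_set_scope.
Local Open Scope ring_scope.

(** * Banach spaces *)

Section ProductComplete.
Variables (R : realType) (E F : completeNormedModType R).

HB.instance Definition _ := Pointed.on (E * F)%type.

Lemma prod_cauchy_cvg (G : set_system (E * F)%type) :
  ProperFilter G -> cauchy G -> cvg G.
Proof.
move=> PG /cauchy_ballP cG.
have c1 : cauchy (fst @ G).
  apply/cauchy_ballP => e e0; have := cG e e0; rewrite !near_simpl /=.
  case=> -[A B] /= [GA GB] AB; exists (fst @` A, fst @` B) => /=.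
    by split; [apply: filterS GA|apply: filterS GB] => p ?; exists p.
  by move=> [x y] /= [[p Ap <-] [q Bq <-]]; case: (AB (p, q)).
have c2 : cauchy (snd @ G).
  apply/cauchy_ballP => e e0; have := cG e e0; rewrite !near_simpl /=.
  case=> -[A B] /= [GA GB] AB; exists (snd @` A, snd @` B) => /=.
    by split; [apply: filterS GA|apply: filterS GB] => p ?; exists p.
  by move=> [x y] /= [[p Ap <-] [q Bq <-]]; case: (AB (p, q)).
have /cvg_ex[x xP] : cvg (fst @ G) by exact: cauchy_cvg.
have /cvg_ex[y yP] : cvg (snd @ G) by exact: cauchy_cvg.
apply/cvg_ex; exists (x, y) => A [[B C] /= [Bx Cy] BCA].
have GB := xP _ Bx; have GC := yP _ Cy.
have GBC : G (fst @^-1` B `&` snd @^-1` C) by exact: filterI.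
by apply: filterS GBC => -[u v] /= [Bu Cv]; exact: BCA.
Qed.

HB.instance Definition _ := Uniform_isComplete.Build (E * F)%type prod_cauchy_cvg.

End ProductComplete.

(** The space L(E, F) of continuous linear maps with the operator norm. *)
Record clin (R : realType) (E F : normedModType R) := CLin {
  clin_fun :> E -> F;
  clin_linear : linear clin_fun;
  clin_continuous : continuous clin_fun }.

Section OperatorSpace.
Variables (R : realType) (E F : normedModType R).
Implicit Types S T U : clin E F.

HB.instance Definition _ T := GRing.isLinear.Build R E F _ T (clin_linear T).

Lemma clinP S T : (forall v, S v = T v) -> S = T.
Proof.
case: S T => [S lS cS] [T lT cT] /= /funext ST.
by subst T; congr CLin; exact: Prop_irrelevance.
Qed.

HB.instance Definition _ := gen_eqMixin (clin E F).
HB.instance Definition _ := gen_choiceMixin (clin E F).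

Fact clin0_linear : linear ((fun=> 0) : E -> F).
Proof. by move=> a u v; rewrite scaler0 addr0. Qed.
Definition clin0 := CLin clin0_linear (fun x => cvg_cst (0 : F)).

Fact clinD_linear S T : linear (fun v : E => S v + T v).
Proof. by move=> a u v; rewrite !linearP scalerDr addrACA. Qed.
Fact clinD_continuous S T : continuous (fun v : E => S v + T v).
Proof. by move=> x; apply: cvgD; exact: clin_continuous. Qed.
Definition clinD S T := CLin (clinD_linear S T) (@clinD_continuous S T).

Fact clinZ_linear (c : R) T : linear (fun v : E => c *: T v).
Proof. by move=> a u v; rewrite linearP scalerDr !scalerA mulrC. Qed.
Fact clinZ_continuous (c : R) T : continuous (fun v : E => c *: T v).
Proof. by move=> x; apply: cvgZr; exact: clin_continuous. Qed.
Definition clinZ c T := CLin (clinZ_linear c T) (@clinZ_continuous c T).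

Fact clinN_linear T : linear (fun v : E => - T v).
Proof. by move=> a u v; rewrite linearP opprD scalerN. Qed.
Fact clinN_continuous T : continuous (fun v : E => - T v).
Proof. by move=> x; apply: cvgN; exact: clin_continuous. Qed.
Definition clinN T := CLin (clinN_linear T) (@clinN_continuous T).

Fact clinDA : associative clinD.
Proof. by move=> S T U; apply: clinP => v; exact: addrA. Qed.
Fact clinDC : commutative clinD.
Proof. by move=> S T; apply: clinP => v; exact: addrC. Qed.
Fact clin0D : left_id clin0 clinD.
Proof. by move=> T; apply: clinP => v; exact: add0r. Qed.
Fact clinND : left_inverse clin0 clinN clinD.
Proof. by move=> T; apply: clinP => v; exact: addNr. Qed.
HB.instance Definition _ :=
  GRing.isZmodule.Build (clin E F) clinDA clinDC clin0D clinND.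

Fact clinZA a b T : clinZ a (clinZ b T) = clinZ (a * b) T.
Proof. by apply: clinP => v; exact: scalerA. Qed.
Fact clin1Z : left_id 1 clinZ.
Proof. by move=> T; apply: clinP => v; exact: scale1r. Qed.
Fact clinZDr : right_distributive clinZ +%R.
Proof. by move=> a S T; apply: clinP => v; exact: scalerDr. Qed.
Fact clinZDl T : {morph clinZ^~ T : a b / a + b}.
Proof. by move=> a b; apply: clinP => v; exact: scalerDl. Qed.
HB.instance Definition _ :=
  GRing.Zmodule_isLmodule.Build R (clin E F) clinZA clin1Z clinZDr clinZDl.

Definition opnorm T : R := sup [set `|T v| | v in [set v | `|v| <= 1]].

Lemma opnorm_has_sup T : has_sup [set `|T v| | v in [set v | `|v| <= 1]].
Proof.
split; first by exists `|T 0|; exists 0 => //=; rewrite normr0.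
have /linear_boundedP : bounded_near (T : {linear E -> F}) (nbhs 0).
  by apply: continuous_linear_bounded; exact: clin_continuous.
move=> /pinfty_ex_gt0[M M0 TM]; exists M => _ [v /= v1 <-].
by rewrite (le_trans (TM v))// ler_piMr// ltW.
Qed.

Lemma opnorm_ub T v : `|v| <= 1 -> `|T v| <= opnorm T.
Proof. by move=> v1; apply: (sup_upper_bound (opnorm_has_sup T)); exists v. Qed.

Lemma opnorm_le T (M : R) :
  (forall v, `|v| <= 1 -> `|T v| <= M) -> opnorm T <= M.
Proof.
move=> TM; apply: ge_sup; first by case: (opnorm_has_sup T).
by move=> _ [v /= v1 <-]; exact: TM.
Qed.

Lemma opnorm_ge0 T : 0 <= opnorm T.
Proof. by apply: le_trans (opnorm_ub T (_ : `|0| <= 1)); rewrite ?normr0. Qed.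

Lemma le_opnorm T v : `|T v| <= opnorm T * `|v|.
Proof.
have [->|v0] := eqVneq v 0; first by rewrite linear0 !normr0 mulr0.
have nv : 0 < `|v| by rewrite normr_gt0.
rewrite -ler_pdivrMr// mulrC -[X in X * _]gtr0_norm ?invr_gt0// -normrZ -linearZ.
by apply: opnorm_ub; rewrite normrZ gtr0_norm ?invr_gt0// mulVf ?gt_eqF.
Qed.

Fact opnormD S T : opnorm (S + T) <= opnorm S + opnorm T.
Proof.
apply: opnorm_le => v v1.
by apply: le_trans (ler_normD _ _) _; rewrite lerD// opnorm_ub.
Qed.

Fact opnormZ (a : R) T : opnorm (a *: T) = `|a| * opnorm T.
Proof.
have leZ (b : R) U : opnorm (b *: U) <= `|b| * opnorm U.
  by apply: opnorm_le => v v1; rewrite [leLHS]normrZ ler_wpM2l// opnorm_ub.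
apply/eqP; rewrite eq_le leZ /=.
have [->|a0] := eqVneq a 0; first by rewrite normr0 mul0r opnorm_ge0.
rewrite -ler_pdivlMl ?normr_gt0// -normfV.
by rewrite -{1}[T]scale1r -(mulVf a0) -scalerA leZ.
Qed.

Fact opnorm_eq0 T : opnorm T = 0 -> T = 0.
Proof.
move=> T0; apply: clinP => v; apply/eqP; rewrite -normr_eq0 eq_le normr_ge0 andbT.
by have := le_opnorm T v; rewrite T0 mul0r.
Qed.

HB.instance Definition _ :=
  Lmodule_isNormed.Build R (clin E F) opnormD opnormZ opnorm_eq0.

End OperatorSpace.

(** * Smooth maps between Banach spaces *)

Section Smooth.
Variable R : realType.

Lemma near_diff (E F : normedModType R) (f g : E -> F) x :
  (\forall y \near x, f y = g y) -> differentiable g x ->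
  'd f x = 'd g x :> (E -> F).
Proof.
move=> fg dg; apply: diff_unique; first exact: diff_continuous.
rewrite (nbhs_singleton fg); apply/eqaddoP => e e0.
have /eqaddoP/(_ e e0) := diff_locally dg.
move: fg; rewrite (near_shift 0) subr0; apply: filterS2 => h /= fgh.
by rewrite !fctE /= fgh.
Qed.

(** Class C^n on an open set [U], the derivative being the Fréchet derivative
    regarded as a map into the operator space.  Values of [f] outside [U] are
    irrelevant. *)
Fixpoint Cn (n : nat) (E F : normedModType R) (U : set E) (f : E -> F) : Prop :=
  if n is m.+1 then
    exists2 f' : E -> clin E F,
      forall x, U x -> is_diff x f (f' x) & Cn m U f'
  else forall x, U x -> {for x, continuous f}.

Definition smooth_on (E F : normedModType R) (U : set E) (f : E -> F) : Prop :=
  open U /\ forall n, Cn n U f.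

End Smooth.

(** * Banach manifolds *)

(** A covering of a set by charts with values in Banach spaces, which may differ
    from one chart to another.  [chart i] and its inverse [chartV i] are total
    functions, only meaningful on [dom i] and on its image.  The topology is the
    one induced by the charts; no separation axiom is imposed. *)
Record atlas (R : realType) := Atlas {
  carrier :> Type;
  chart_idx : Type;
  model : chart_idx -> completeNormedModType R;
  dom : chart_idx -> set carrier;
  chart : forall i, carrier -> model i;
  chartV : forall i, model i -> carrier;
  chartK : forall i x, dom i x -> chartV (chart i x) = x;
  chart_cover : forall x, exists i, dom i x }.

Arguments dom {R} a _ _ : rename.
Arguments chart {R a} i x : rename.
Arguments chartV {R a} i y : rename.

Section Maps.
Variable R : realType.
Implicit Types A B : atlas R.

Definition open_in A (U : set A) : Prop :=
  forall i, open (chart i @` (dom A i `&` U)).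

Definition local_rep A B (f : A -> B) i j : model i -> model j :=
  chart j \o f \o chartV i.

(** Openness of the domains of the local representatives, contained in
    [smooth_on], expresses that [U] is open and [f] is continuous on [U]. *)
Definition smooth_map_on A B (U : set A) (f : A -> B) : Prop :=
  forall i j, smooth_on (chart i @` (dom A i `&` U `&` f @^-1` dom B j))
                        (@local_rep A B f i j).

Definition smooth_map A B (f : A -> B) : Prop := smooth_map_on setT f.

Definition smooth_fun_on A (F : normedModType R) (U : set A) (g : A -> F) : Prop :=
  forall i, smooth_on (chart i @` (dom A i `&` U)) (g \o chartV i).

(** The case [i = j] says that the images of the charts are open. *)
Definition smooth_transitions A : Prop :=
  forall i j, smooth_on (chart i @` (dom A i `&` dom A j))
                        (chart j \o chartV i : model i -> model j).

Definition chart_at A (x : A) : chart_idx A := projT1 (cid (chart_cover x)).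

Lemma chart_atP A (x : A) : dom A (chart_at x) x.
Proof. by rewrite /chart_at; case: cid. Qed.

End Maps.

Record manifold (R : realType) := Manifold {
  manifold_atlas :> atlas R;
  manifold_smooth : smooth_transitions manifold_atlas }.

Section ProductWithSpace.
Variables (R : realType) (A : atlas R) (F : completeNormedModType R).

Definition prod_dom (i : chart_idx A) : set (A * F) := [set p | dom A i p.1].
Definition prod_chart (i : chart_idx A) (p : A * F) : model i * F :=
  (chart i p.1, p.2).
Definition prod_chartV (i : chart_idx A) (q : model i * F) : A * F :=
  (chartV i q.1, q.2).

Fact prod_chartK i p : prod_dom i p -> prod_chartV (prod_chart i p) = p.
Proof. by case: p => x v /= ?; rewrite /prod_chartV /= chartK. Qed.

Fact prod_chart_cover (p : A * F) : exists i, prod_dom i p.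
Proof. by have [i ?] := chart_cover p.1; exists i. Qed.

Definition prod_atlas : atlas R :=
  @Atlas R (A * F)%type (chart_idx A)
    (fun i => (model i * F)%type : completeNormedModType R)
    prod_dom prod_chart prod_chartV prod_chartK prod_chart_cover.

End ProductWithSpace.

(** * Tangent vectors *)

Section Tangent.
Variables (R : realType) (A : atlas R).

(** A tangent vector at [x] is a class of pairs (chart [i] at [x], vector of the
    model space of [i]) for the relation
    (i, v) ~ (j, w) iff w = d(chart j o (chart i)^-1)(chart i x) v. *)
Definition tangent_class (x : A) (i : chart_idx A) (v : model i) :
    set {j : chart_idx A & model j} :=
  [set p | dom A (projT1 p) x /\
           projT2 p = 'd (chart (projT1 p) \o chartV i) (chart i x) v].

Record tangent := Tangent {
  base : A;
  tclass : set {j : chart_idx A & model j};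
  tclassP : exists i v, dom A i base /\ tclass = @tangent_class base i v }.

Fact tangent_classP x i v (xi : dom A i x) :
  exists j w, dom A j x /\ @tangent_class x i v = @tangent_class x j w.
Proof. by exists i, v. Qed.

(** The tangent vector at [x] represented by [v] in the chart [i]; the value is
    junk (but still a tangent vector at [x]) when [i] is not a chart at [x]. *)
Definition tvec (i : chart_idx A) (x : A) (v : model i) : tangent :=
  if pselect (dom A i x) is left xi then Tangent (tangent_classP v xi)
  else Tangent (tangent_classP (0 : model (chart_at x)) (chart_atP x)).

Definition tcoord (i : chart_idx A) (X : tangent) : model i :=
  xget 0 [set v | tclass X (existT _ i v)].

Lemma base_tvec i x v : base (@tvec i x v) = x.
Proof. by rewrite /tvec; case: pselect. Qed.

Definition tangent_dom (i : chart_idx A) : set tangent :=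
  [set X | dom A i (base X)].
Definition tangent_chart (i : chart_idx A) (X : tangent) : model i * model i :=
  (chart i (base X), tcoord i X).
Definition tangent_chartV (i : chart_idx A) (q : model i * model i) : tangent :=
  tvec (chartV i q.1) q.2.

Lemma tangent_eq x C C' p p' : C = C' -> @Tangent x C p = @Tangent x C' p'.
Proof. by move=> CC'; subst C'; congr Tangent; exact: Prop_irrelevance. Qed.

Lemma tcoordE x C p i j (v : model j) (xi : dom A i x) :
  C = tangent_class x v ->
  tcoord i (@Tangent x C p) = 'd (chart i \o chartV j) (chart j x) v.
Proof.
move=> CE; apply: xget_unique => /=; first by rewrite CE.
by move=> y; rewrite CE => -[].
Qed.

End Tangent.

Arguments Tangent {R A}.

Section TangentAtlas.
Variables (R : realType) (A : manifold R).

Lemma diff_transition (x : A) i j k : dom A i x -> dom A j x -> dom A k x ->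
  'd (chart k \o chartV j : model j -> model k) (chart j x) =
  'd (chart k \o chartV i : model i -> model k) (chart i x) \o
  'd (chart i \o chartV j : model j -> model i) (chart j x)
    :> (model j -> model k).
Proof.
move=> xi xj xk.
have [oij sij] := @manifold_smooth _ A j i.
have [_ sik] := @manifold_smooth _ A i k.
have [f' f'P _] := sij 1%N; have [g' g'P _] := sik 1%N.
have df : differentiable (chart i \o chartV j : model j -> model i) (chart j x).
  by have [] := f'P (chart j x) (imageP _ (conj xj xi)).
have fx : (chart i \o chartV j) (chart j x) = chart i x by rewrite /= chartK.
have dg : differentiable (chart k \o chartV i : model i -> model k)
    ((chart i \o chartV j) (chart j x)).
  by rewrite fx; have [] := g'P (chart i x) (imageP _ (conj xi xk)).
rewrite -fx; apply: (etrans _ (diff_comp df dg)).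
apply: near_diff; last exact: differentiable_comp.
have : nbhs (chart j x) (chart j @` (dom A j `&` dom A i)).
  by apply: open_nbhs_nbhs; split => //; exact: imageP.
by apply: filterS => _ [z [zj zi] <-] /=; rewrite !chartK.
Qed.

Fact tangent_chartK (i : chart_idx A) (X : tangent A) :
  tangent_dom i X -> tangent_chartV (tangent_chart i X) = X.
Proof.
case: X => x C p xi; rewrite /tangent_dom /= in xi.
have [j [v [xj CE]]] := p.
rewrite /tangent_chartV /tangent_chart /= chartK// (tcoordE p xi CE).
rewrite /tvec; case: pselect => // xi'; apply: tangent_eq.
rewrite CE; apply/seteqP.
by split=> -[k u] [/= xk uE]; split=> //=;
  rewrite uE (diff_transition xi xj xk).
Qed.

Fact tangent_chart_cover (X : tangent A) : exists i, tangent_dom i X.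
Proof. exact: chart_cover (base X). Qed.

Definition tangent_atlas : atlas R :=
  @Atlas R (tangent A) (chart_idx A)
    (fun i => (model i * model i)%type : completeNormedModType R)
    (@tangent_dom R A) (@tangent_chart R A) (@tangent_chartV R A)
    tangent_chartK tangent_chart_cover.

End TangentAtlas.

Section TangentMap.
Variables (R : realType) (A B : atlas R).

Definition tangent_map (f : A -> B) (X : tangent A) : tangent B :=
  let i := chart_at (base X) in
  let j := chart_at (f (base X)) in
  tvec (f (base X))
    ('d (@local_rep R A B f i j) (chart i (base X)) (tcoord i X) : model j).

(** The velocity at time [t] of the path [c]. *)
Definition velocity (c : R -> A) (t : R) : tangent A :=
  let j := chart_at (c t) in
  tvec (c t) (derive1 (chart j \o c : R -> model j) t).

End TangentMap.

(** * Vector bundles *)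

(** A projection together with a trivializing covering: over [tdom a] the total
    space is identified with [tdom a * fib a] by [e |-> (proj e, triv a e)], with
    inverse [trivV a].  The fibers carry the linear and topological structure
    transported from the Banach spaces [fib a].  The axioms are separated, in
    [is_vector_bundle], from the data. *)
Record bundle_data (R : realType) (E B : atlas R) := BundleData {
  proj : E -> B;
  triv_idx : Type;
  fib : triv_idx -> completeNormedModType R;
  tdom : triv_idx -> set B;
  triv : forall a, E -> fib a;
  trivV : forall a, B -> fib a -> E;
  triv_cover : forall z, exists a, tdom a z }.

Arguments proj {R E B} b e : rename.
Arguments tdom {R E B} b a _ : rename.
Arguments triv {R E B b} a e : rename.
Arguments trivV {R E B b} a z v : rename.

Section Bundles.
Variables (R : realType) (E B : atlas R) (P : bundle_data E B).

(** Smooth maps z |-> T_z of a subset of a manifold into L(F, G), for the operator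
    norm, given by their values T_z v. *)
Definition smooth_operator_family (A : atlas R) (U : set A)
    (F G : normedModType R) (T : A -> F -> G) : Prop :=
  exists T' : A -> clin F G,
    (forall z, U z -> forall v, T' z v = T z v) /\ smooth_fun_on U T'.

Definition is_trivialization (a : triv_idx P) : Prop :=
  [/\ open_in (tdom P a),
      forall z v, tdom P a z ->
        proj P (trivV a z v) = z /\ triv a (trivV a z v) = v,
      forall e, tdom P a (proj P e) -> trivV a (proj P e) (triv a e) = e,
      @smooth_map_on R E (prod_atlas B (fib a)) (proj P @^-1` tdom P a)
        (fun e => (proj P e, triv a e)) &
      @smooth_map_on R (prod_atlas B (fib a)) E [set p | tdom P a p.1]
        (fun p => trivV a p.1 p.2)].

Definition is_vector_bundle : Prop :=
  [/\ smooth_map (proj P),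
      forall a, is_trivialization a &
      forall a b, smooth_operator_family (tdom P a `&` tdom P b)
        (fun z (v : fib a) => triv b (trivV a z v))].

Definition triv_at (z : B) : triv_idx P := projT1 (cid (triv_cover P z)).

(** The path t |-> xi + t eta in the fiber of [xi], for [xi] and [eta] in the
    same fiber. *)
Definition fiber_line (xi eta : E) (t : R) : E :=
  let z := proj P xi in
  let a := triv_at z in
  trivV a z (triv a xi + t *: triv a eta).

Definition vertical_lift (xi eta : E) : tangent E :=
  velocity (fiber_line xi eta) 0.

End Bundles.

Record vector_bundle (R : realType) (E B : manifold R) := VectorBundle {
  vb_data :> bundle_data E B;
  vb_axioms : is_vector_bundle vb_data }.

Section Morphisms.
Variables (R : realType) (E B E' B' : atlas R).
Variables (P : bundle_data E B) (P' : bundle_data E' B').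

(** Besides smoothness of the pair, the local maps on the fibers are required to
    be linear, continuous, and to depend smoothly on the base point for the
    operator norm. *)
Definition vb_morphism (f : E -> E') (f0 : B -> B') : Prop :=
  [/\ smooth_map f, smooth_map f0,
      forall e, proj P' (f e) = f0 (proj P e) &
      forall a b, smooth_operator_family (tdom P a `&` f0 @^-1` tdom P' b)
        (fun z (v : fib a) => triv b (f (trivV a z v)))].

(** [f] restricts to a topological linear isomorphism from the fiber over [z]
    onto the fiber over [f0 z], for all [z]. *)
Definition fiberwise_iso (f : E -> E') (f0 : B -> B') : Prop :=
  forall z a b, tdom P a z -> tdom P' b (f0 z) ->
    exists (S : clin (fib a) (fib b)) (T : clin (fib b) (fib a)),
      [/\ cancel S T, cancel T S &
          forall v, triv b (f (trivV a z v)) = S v].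

End Morphisms.

Definition tangent_bundle (R : realType) (M : manifold R) :
    bundle_data (tangent_atlas M) M :=
  @BundleData R (tangent_atlas M) M
    (@base R M) (chart_idx M) (@model R M) (dom M)
    (@tcoord R M) (@tvec R M) (@chart_cover R M).

Definition connection_map (R : realType) (D Z : manifold R)
    (P : vector_bundle D Z) (K : tangent_atlas D -> D) : Prop :=
  [/\ smooth_map K,
      forall X, proj P (K X) = proj P (proj (tangent_bundle D) X),
      vb_morphism (tangent_bundle D) P K (proj P) &
      forall xi eta, proj P xi = proj P eta -> K (vertical_lift P xi eta) = eta].

(* Main.v *)
From HB Require Import structures.
Require Import Defs.
From mathcomp Require Import all_boot all_order all_algebra.
From mathcomp Require Import all_classical all_reals topology normedtype derive.
From mathcomp Require Import landau ring lra.
(* Here [proj] has to be the projection of a bundle, not of a product. *)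
Import Defs.

Set Implicit Arguments.
Unset Strict Implicit.
Unset Printing Implicit Defensive.

Import Order.TTheory GRing.Theory Num.Theory.
Import numFieldNormedType.Exports.

Local Open Scope classical_set_scope.
Local Open Scope ring_scope.

(** Write z for the base point of the fibre containing the foot point of a
    tangent vector X of D.  The vector K'(T delta X) lies in the fibre of D'
    over zeta z, and delta maps the fibre over z bijectively onto that fibre, so
    K X is forced to be the unique vector over z with
    delta (K X) = K'(T delta X).  This gives uniqueness, and the equation
    defines K; what remains is to see that K is a connection map.

    Smoothness.  In a chart i of D, a trivialization a of D, a chart j of D' and
    a trivialization b of D', the operator v |-> K(e, v) is the product
      S(z)^-1 o K'_(j,b)(delta e) o d(delta_(i,j))(e),
    where z is the projection of e, S(z) is the isomorphism of fibres read in a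
    and b, and K'_(j,b) is the operator family of K' ([pullback_family]).  Each
    factor is smooth in e for the operator norm: the first because inversion of
    operators is smooth ([Cn_inverse]), the second because K' is a bundle
    morphism, the third because the derivative of a smooth map is smooth.
    Composition of operators is a bounded bilinear map, hence the product is
    smooth ([Cn_bilinear]), and smoothness is a local property, so that j and b
    may depend on e ([smooth_operator_family_local]).  Smoothness of the map K
    itself follows, since (e, v) |-> K(e, v) is obtained by composing the
    operator family, the evaluation of operators and a trivialization
    ([smooth_map_of_families]).

    Vertical vectors.  As delta is linear on fibres, it maps the path
    xi + t eta to delta xi + t delta eta ([delta_fiber_line]), so T delta maps
    the vertical lift of (xi, eta) to that of (delta xi, delta eta)
    ([tangent_map_vertical_lift]).  Hence delta (K X) = delta eta for X the
    vertical lift of (xi, eta), and K X = eta by injectivity on fibres. *)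

(** * Continuous linear and bilinear maps *)

Section BoundedLinear.
Variables (R : realType) (E F : normedModType R).

Lemma le_bound_continuous (f : E -> F) (M : R) :
  linear f -> (forall v, `|f v| <= M * `|v|) -> continuous f.
Proof.
move=> lf fM.
pose g : {linear E -> F} := HB.pack f (GRing.isLinear.Build R E F _ f lf).
apply: (linear_bounded_continuous g).1.
apply/linear_boundedP; near=> r => v.
by rewrite (le_trans (fM v))// ler_wpM2r.
Unshelve. all: by end_near. Qed.

(** The operator defined by a linear map f with |f v| <= M |v|. *)
Definition bounded_clin (f : E -> F) (lf : linear f) (M : R)
    (fM : forall v, `|f v| <= M * `|v|) : clin E F :=
  CLin lf (le_bound_continuous lf fM).

Lemma clin_sub (T : clin E F) u v : T (u - v) = T u - T v.
Proof. exact: linearB. Qed.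

Lemma clin_norm_le (T : clin E F) (M : R) : 0 <= M ->
  (forall v, `|T v| <= M * `|v|) -> `|T| <= M.
Proof.
move=> M0 TM; apply: opnorm_le => v v1.
by rewrite (le_trans (TM v))// ler_piMr.
Qed.

Lemma le_clin_norm (T : clin E F) v : `|T v| <= `|T| * `|v|.
Proof. exact: le_opnorm. Qed.

Lemma is_diff_clin (T : clin E F) x : is_diff x T T.
Proof.
split; first by apply: linear_differentiable; exact: clin_continuous.
by apply: diff_lin; exact: clin_continuous.
Qed.

End BoundedLinear.

Section Composition.
Variables (R : realType) (E F G : normedModType R).

Fact clin_comp_linear (S : clin F G) (T : clin E F) : linear (S \o T).
Proof. by move=> a u v; rewrite /= !linearP. Qed.
Fact clin_comp_continuous (S : clin F G) (T : clin E F) : continuous (S \o T).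
Proof. by move=> x; apply: continuous_comp; exact: clin_continuous. Qed.
(** The product of two operators. *)
Definition clin_comp (S : clin F G) (T : clin E F) : clin E G :=
  CLin (clin_comp_linear S T) (@clin_comp_continuous S T).

Lemma clin_comp_norm S T : `|clin_comp S T| <= `|S| * `|T|.
Proof.
apply: clin_norm_le => [|v]; first exact: mulr_ge0.
rewrite (le_trans (le_clin_norm S (T v)))// -mulrA ler_wpM2l//.
exact: le_clin_norm.
Qed.

(** Composition as a continuous bilinear map of operators.  A bilinear map is
    represented in curried form, as an operator with values in operators: such
    a map is bounded by construction. *)
Fact compL_linear (S : clin F G) : linear (clin_comp S : clin E F -> clin E G).
Proof. by move=> a T U; apply: clinP => v; exact: linearP. Qed.
Definition compL (S : clin F G) : clin (clin E F) (clin E G) :=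
  bounded_clin (compL_linear S) (clin_comp_norm S).

Fact comp_op_linear : linear compL.
Proof. by move=> a S S'; apply: clinP => T; exact: clinP. Qed.
Fact comp_op_bound S : `|compL S| <= 1 * `|S|.
Proof.
by rewrite mul1r; apply: clin_norm_le => // T; exact: clin_comp_norm.
Qed.
Definition comp_op : clin (clin F G) (clin (clin E F) (clin E G)) :=
  bounded_clin comp_op_linear comp_op_bound.

(** Exchange of the two arguments of a curried bilinear map. *)
Section Flip.
Variable B : clin E (clin F G).

Fact flip1_linear (v : F) : linear (fun u => B u v).
Proof. by move=> a u u'; rewrite linearP. Qed.
Fact flip1_bound (v : F) u : `|B u v| <= `|B| * `|v| * `|u|.
Proof.
rewrite (le_trans (le_clin_norm (B u) v))// mulrAC ler_wpM2r//.
exact: le_clin_norm.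
Qed.
Definition flip1 (v : F) : clin E G :=
  bounded_clin (@flip1_linear v) (@flip1_bound v).

Fact flip_linear : linear flip1.
Proof. by move=> a v v'; apply: clinP => u; exact: linearP. Qed.
Fact flip_bound v : `|flip1 v| <= `|B| * `|v|.
Proof.
by apply: clin_norm_le => [|u]; [exact: mulr_ge0|exact: flip1_bound].
Qed.
Definition flip : clin F (clin E G) := bounded_clin flip_linear flip_bound.

End Flip.
End Composition.

Section Pairs.
Variables (R : realType) (E F : normedModType R).

Fact clin_fst_linear : linear (fst : E * F -> E). Proof. by []. Qed.
Fact clin_snd_linear : linear (snd : E * F -> F). Proof. by []. Qed.
Definition clin_fst : clin (E * F)%type E :=
  CLin clin_fst_linear (fun x => @cvg_fst _ _ _ _ _).
Definition clin_snd : clin (E * F)%type F :=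
  CLin clin_snd_linear (fun x => @cvg_snd _ _ _ _ _).
Fact clin_inl_linear : linear (fun u : E => (u, 0 : F)).
Proof. by move=> a u v; apply/pair_equal_spec; rewrite /= scaler0 addr0. Qed.
Fact clin_inr_linear : linear (fun v : F => (0 : E, v)).
Proof. by move=> a u v; apply/pair_equal_spec; rewrite /= scaler0 addr0. Qed.
Fact clin_inl_continuous : continuous (fun u : E => (u, 0 : F)).
Proof. by move=> x; apply: cvg_pair => //; exact: cvg_cst. Qed.
Fact clin_inr_continuous : continuous (fun v : F => (0 : E, v)).
Proof. by move=> x; apply: cvg_pair => //; exact: cvg_cst. Qed.
Definition clin_inl : clin E (E * F)%type :=
  CLin clin_inl_linear clin_inl_continuous.
Definition clin_inr : clin F (E * F)%type :=
  CLin clin_inr_linear clin_inr_continuous.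
End Pairs.

Section ClinId.
Variables (R : realType) (E : normedModType R).
Fact clin_id_linear : linear (id : E -> E). Proof. by []. Qed.
Definition clin_id : clin E E := CLin clin_id_linear (fun x => cvg_id).
End ClinId.

(** * Fréchet derivatives *)

Section Derivatives.
Variables (R : realType).
Implicit Types E F G H : normedModType R.

Lemma is_diffP E F (f : E -> F) (T : clin E F) x :
  is_diff x f T <->
  forall e, 0 < e ->
    \forall h \near (0 : E), `|f (h + x) - f x - T h| <= e * `|h|.
Proof.
split=> [[df dfT] e e0|fT].
  have /eqaddoP/(_ e e0) := diff_locally df.
  apply: filterS => h; rewrite dfT; rewrite !fctE /=.
  by rewrite opprD addrA.
have dfE : f \o shift x = cst (f x) + T +o_ 0 id.
  apply/eqaddoP => e e0; have := fT e e0; apply: filterS => h.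
  by rewrite !fctE /= opprD addrA.
have dT : 'd f x = T :> (E -> F).
  by apply: diff_unique => //; exact: clin_continuous.
split=> //; apply/diff_locallyP; rewrite dT; split=> //; exact: clin_continuous.
Qed.

Lemma near_is_diff E F (f g : E -> F) (T : clin E F) x :
  (\forall y \near x, f y = g y) -> is_diff x f T -> is_diff x g T.
Proof.
move=> fg /is_diffP fT; apply/is_diffP => e e0.
have := fT e e0; rewrite -(nbhs_singleton fg).
move: fg; rewrite (near_shift 0) subr0; apply: filterS2 => h /= fgh.
by rewrite fgh.
Qed.

Lemma is_diff_unique E F (f : E -> F) (S T : clin E F) x :
  is_diff x f S -> is_diff x f T -> S = T.
Proof. by move=> [_ fS] [_ fT]; apply: clinP => v; rewrite -fS fT. Qed.

Lemma is_diff_continuous E F (f : E -> F) (T : clin E F) x :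
  is_diff x f T -> {for x, continuous f}.
Proof. by move=> [+ _]; exact: differentiable_continuous. Qed.

Lemma near0_norm_le E (e : R) : 0 < e -> \forall h \near (0 : E), `|h| <= e.
Proof. exact: nbhs0_le. Qed.

Lemma is_diff_bilinear E F G (B : clin E (clin F G)) p :
  is_diff p (fun q : E * F => B q.1 q.2)
    (clin_comp (flip B p.2) (clin_fst E F) + clin_comp (B p.1) (clin_snd E F)).
Proof.
(* The remainder of the expansion at p is B h.1 h.2, of order |h|^2. *)
have aux (a b c d : G) : a + b + (c + d) - d - (b + c) = a.
  by rewrite addrA addrK opprD addrA (addrAC _ c) !addrK.
have BE (h : E * F) : B (h + p).1 (h + p).2 - B p.1 p.2 -
  (clin_comp (flip B p.2) (clin_fst E F) + clin_comp (B p.1) (clin_snd E F)) h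
  = B h.1 h.2.
  rewrite [(_ + _ : clin _ _) h]/(B h.1 p.2 + B p.1 h.2) /=.
  rewrite (linearD B).
  rewrite [(_ + _ : clin _ _) _]/(B h.1 (h.2 + p.2) + B p.1 (h.2 + p.2)).
  by rewrite (linearD (B h.1)) (linearD (B p.1)) aux.
apply/is_diffP => e e0.
have d0 : 0 < e / (`|B| + 1) by rewrite divr_gt0 ?ltr_wpDl.
apply: filterS (near0_norm_le _ d0) => h hd; rewrite BE.
have h1 : `|h.1| <= `|h| by rewrite [leRHS]prod_normE le_max lexx.
have h2 : `|h.2| <= `|h| by rewrite [leRHS]prod_normE le_max lexx orbT.
apply: le_trans (le_clin_norm (B h.1) h.2) _.
apply: ler_pM => //; apply: le_trans (le_clin_norm B h.1) _.
apply: le_trans (_ : (`|B| + 1) * `|h| <= _).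
  by apply: ler_pM => //; rewrite lerDl.
by rewrite -ler_pdivlMl ?ltr_wpDl// mulrC.
Qed.

End Derivatives.

(** * Maps of class C^n *)

Section ClassCn.
Variable R : realType.
Implicit Types E F G H : normedModType R.

(** The Fréchet derivative as a total map into the operator space, with value 0
    where the map is not differentiable. *)
Definition derivative E F (f : E -> F) (x : E) : clin E F :=
  xget 0 [set T : clin E F | is_diff x f T].

Lemma derivativeE E F (f : E -> F) x (T : clin E F) :
  is_diff x f T -> derivative f x = T.
Proof.
by move=> fT; apply: xget_unique => // S fS; exact: is_diff_unique fS fT.
Qed.

Lemma is_diff_derivative E F (f : E -> F) x (T : clin E F) :
  is_diff x f T -> is_diff x f (derivative f x).
Proof. by move=> fT; rewrite (derivativeE fT). Qed.

Lemma near_continuous E F (f g : E -> F) x :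
  (\forall y \near x, f y = g y) ->
  {for x, continuous f} -> {for x, continuous g}.
Proof.
move=> fg; rewrite /prop_for /continuous_at -(nbhs_singleton fg) => fx.
by apply: cvg_trans fx; apply: near_eq_cvg; apply: filterS fg => y /esym.
Qed.

Lemma Cn_eq n E F (U : set E) (f g : E -> F) : open U ->
  (forall x, U x -> f x = g x) -> Cn n U f -> Cn n U g.
Proof.
move=> oU fg; have nfg x (Ux : U x) : \forall y \near x, f y = g y.
  by apply: filterS (open_nbhs_nbhs (conj oU Ux)) => y; exact: fg.
case: n => [|n] /= Cf.
  by move=> x Ux; apply: near_continuous (nfg x Ux) (Cf x Ux).
case: Cf => f' ff' Cf'; exists f' => // x Ux.
exact: near_is_diff (nfg x Ux) (ff' x Ux).
Qed.

Lemma Cn_sub n E F (U V : set E) (f : E -> F) :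
  V `<=` U -> Cn n U f -> Cn n V f.
Proof.
move=> VU; elim: n F f => [|n IH] F f /=; first by move=> Cf x /VU; exact: Cf.
by case=> f' ff' Cf'; exists f'; [move=> x /VU; exact: ff'|exact: IH].
Qed.

Lemma CnS n E F (U : set E) (f : E -> F) : Cn n.+1 U f -> Cn n U f.
Proof.
elim: n F f => [|n IH] F f [f' ff' Cf'].
  by move=> x Ux; exact: is_diff_continuous (ff' x Ux).
by exists f' => //; exact: IH.
Qed.

Lemma Cn_derivative n E F (U : set E) (f : E -> F) : open U ->
  Cn n.+1 U f -> Cn n U (derivative f).
Proof.
move=> oU [f' ff' Cf']; apply: Cn_eq Cf' => // x Ux.
by rewrite (derivativeE (ff' x Ux)).
Qed.

(** Being of class C^n is a local property: by uniqueness, derivatives chosen on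
    a covering agree with the total map [derivative]. *)
Lemma Cn_local n E F (U : set E) (f : E -> F) :
  (forall x, U x -> exists V, [/\ open V, V x & Cn n V f]) -> Cn n U f.
Proof.
elim: n F f => [|n IH] F f fU.
  by move=> x /fU[V [oV Vx]]; apply.
exists (derivative f) => [x /fU[V [oV Vx [f' ff' _]]]|].
  exact: is_diff_derivative (ff' x Vx).
apply: IH => x /fU[V [oV Vx Cf]]; exists V; split => //.
exact: Cn_derivative.
Qed.

Lemma Cn_cst n E F (U : set E) (c : F) : Cn n U (fun=> c : F).
Proof.
elim: n F c => [|n IH] F c; first by move=> x _; exact: cvg_cst.
by exists (fun=> 0) => [x _|//]; exact: is_diff_cst.
Qed.

Lemma Cn_clin n E F (U : set E) (T : clin E F) : Cn n U T.
Proof.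
case: n => [|n]; first by move=> x _; exact: clin_continuous.
by exists (fun=> T) => [x _|]; [exact: is_diff_clin|exact: Cn_cst].
Qed.

Lemma Cn_clin_comp n E F G (U : set E) (f : E -> F) (T : clin F G) :
  Cn n U f -> Cn n U (fun x => T (f x)).
Proof.
elim: n F G f T => [|n IH] F G f T.
  move=> Cf x Ux; apply: (@continuous_comp _ _ _ f T); first exact: Cf.
  exact: clin_continuous.
case=> f' ff' Cf'.
exists (fun x => compL E T (f' x)) => [x Ux|]; last exact: IH.
exact: (is_diff_comp (ff' x Ux) (is_diff_clin T (f x))).
Qed.

Lemma CnD n E F (U : set E) (f g : E -> F) :
  Cn n U f -> Cn n U g -> Cn n U (fun x => f x + g x).
Proof.
elim: n F f g => [|n IH] F f g.
  by move=> Cf Cg x Ux; apply: cvgD; [exact: Cf|exact: Cg].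
case=> f' ff' Cf' [g' gg' Cg'].
exists (fun x => f' x + g' x) => [x Ux|]; last exact: IH.
exact: (is_diffD (ff' x Ux) (gg' x Ux)).
Qed.

Lemma Cn_pair n E F G (U : set E) (f : E -> F) (g : E -> G) :
  Cn n U f -> Cn n U g -> Cn n U (fun x => (f x, g x)).
Proof.
move=> Cf Cg.
have := CnD (Cn_clin_comp (clin_inl F G) Cf) (Cn_clin_comp (clin_inr F G) Cg).
congr Cn; apply/funext => x.
by apply/pair_equal_spec; rewrite /= addr0 add0r.
Qed.

Lemma is_diff_bilinear_comp E F G H (B : clin F (clin G H)) (f : E -> F)
    (g : E -> G) (S : clin E F) (T : clin E G) x :
  is_diff x f S -> is_diff x g T ->
  is_diff x (fun y => B (f y) (g y))
    (clin_comp (flip B (g x)) S + clin_comp (B (f x)) T).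
Proof.
move=> fS gT; have fgx := is_diff_pair fS gT.
exact: (is_diff_comp fgx (is_diff_bilinear B (f x, g x))).
Qed.

(** The derivative of x |-> B(f x, g x) is built from f', g and f, g' by two
    other bilinear maps, so the induction runs over all bilinear maps at once. *)
Lemma Cn_bilinear n E F G H (B : clin F (clin G H)) (U : set E)
    (f : E -> F) (g : E -> G) :
  Cn n U f -> Cn n U g -> Cn n U (fun x => B (f x) (g x)).
Proof.
elim: n F G H B f g => [|n IH] F G H B f g Cf Cg.
  move=> x Ux; pose B2 (q : F * G) := B q.1 q.2.
  apply: (@continuous_comp _ _ _ (fun y => (f y, g y)) B2).
    by apply: cvg_pair => /=; [exact: Cf|exact: Cg].
  exact: is_diff_continuous (is_diff_bilinear B (f x, g x)).
have := CnS Cf; have := CnS Cg; case: Cf Cg => f' ff' Cf' [g' gg' Cg'] Cg Cf.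
exists (fun x => clin_comp (flip B (g x)) (f' x) + clin_comp (B (f x)) (g' x)).
  by move=> x Ux; exact: is_diff_bilinear_comp (ff' x Ux) (gg' x Ux).
apply: CnD.
  exact: (IH _ _ _ (clin_comp (comp_op E F H) (flip B)) g f').
exact: (IH _ _ _ (clin_comp (comp_op E G H) B) f g').
Qed.

(** By the chain rule, the derivative of g o f is a bilinear expression in
    g' o f and f'. *)
Lemma Cn_comp n E F G (U : set E) (V : set F) (f : E -> F) (g : F -> G) :
  (forall x, U x -> V (f x)) -> Cn n U f -> Cn n V g -> Cn n U (g \o f).
Proof.
move=> fUV; elim: n G g => [|n IH] G g.
  by move=> Cf Cg x Ux; apply: continuous_comp; [exact: Cf|apply/Cg/fUV].
move=> Cf [g' gg' Cg']; have Cf1 := CnS Cf; case: Cf => f' ff' Cf'.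
exists (fun x => clin_comp (g' (f x)) (f' x)).
  by move=> x Ux; exact: (is_diff_comp (ff' x Ux) (gg' (f x) (fUV x Ux))).
by apply: (Cn_bilinear (comp_op E F G)) => //; exact: IH.
Qed.

End ClassCn.

(** * Inversion of operators *)

Section Inversion.
Variables (R : realType) (E F G : normedModType R).
Variables (S : E -> clin F G) (T : E -> clin G F).

(** T x is a two-sided inverse of S x.  The family T of inverses is part of the
    data: what is shown is that it inherits the regularity of S. *)
Definition inverse_at x := cancel (S x) (T x) /\ cancel (T x) (S x).

Lemma inverse_sub x y v : inverse_at x -> inverse_at y ->
  T y v - T x v = - T y ((S y - S x) (T x v)).
Proof.
move=> [_ Tx] [Sy _].
rewrite [(S y - S x) _]/(S y (T x v) - S x (T x v)) Tx clin_sub Sy.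
by rewrite opprB.
Qed.

(** Since T y - T x = - T y (S y - S x) T x, the hypothesis gives
    |T y - T x| <= |T y| / 2, hence |T y| <= 2 |T x|.  The inverse of S y being
    known to exist, no Neumann series is needed. *)
Lemma inverse_lipschitz x y : inverse_at x -> inverse_at y ->
  `|S y - S x| * `|T x| <= 2^-1 ->
  `|T y - T x| <= 2 * `|T x| ^+ 2 * `|S y - S x|.
Proof.
move=> Ix Iy Sxy.
have T1 : `|T y - T x| <= `|T y| * (`|S y - S x| * `|T x|).
  apply: clin_norm_le => [|v]; first by rewrite !mulr_ge0.
  have -> : (T y - T x) v = - T y ((S y - S x) (T x v)) by exact: inverse_sub.
  rewrite normrN.
  rewrite (le_trans (le_clin_norm _ _))// -!mulrA ler_wpM2l//.
  rewrite (le_trans (le_clin_norm _ _))// ler_wpM2l//.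
  exact: le_clin_norm.
have T2 : `|T y| <= 2 * `|T x|.
  have : `|T y| <= `|T y - T x| + `|T x|.
    by apply: le_trans (ler_normD _ _); rewrite subrK.
  have : `|T y - T x| <= `|T y| * 2^-1.
    by rewrite (le_trans T1)// ler_wpM2l.
  lra.
rewrite (le_trans T1)// [leRHS](_ : _ = 2 * `|T x| * (`|S y - S x| * `|T x|)).
  by rewrite ler_wpM2r// mulr_ge0.
ring.
Qed.

Variable x : E.
Hypothesis nearI : \forall y \near x, inverse_at y.

Let Ix : inverse_at x. Proof. exact: nbhs_singleton nearI. Qed.

Lemma inverse_near_lipschitz : {for x, continuous S} ->
  \forall y \near x, `|T y - T x| <= 2 * `|T x| ^+ 2 * `|S y - S x|.
Proof.
move=> cS.
have d0 : 0 < 2^-1 / (`|T x| + 1) :> R by rewrite divr_gt0 ?invr_gt0 ?ltr_wpDl.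
have /cvgr_distC_le/(_ _ d0) := cS.
apply: filterS2 nearI => y Iy Sd; apply: inverse_lipschitz => //.
apply: le_trans (_ : 2^-1 / (`|T x| + 1) * (`|T x| + 1) <= _).
  by apply: ler_pM => //; rewrite lerDl.
by rewrite divfK// gt_eqF// ltr_wpDl.
Qed.

Lemma inverse_continuous : {for x, continuous S} -> {for x, continuous T}.
Proof.
move=> cS; apply/cvgrPdistC_le => e e0.
have a0 : 0 < 2 * `|T x| ^+ 2 + 1 :> R.
  by rewrite ltr_wpDl// mulr_ge0// exprn_ge0.
have d0 : 0 < e / (2 * `|T x| ^+ 2 + 1) by rewrite divr_gt0.
have /cvgr_distC_le/(_ _ d0) := cS.
apply: filterS2 (inverse_near_lipschitz cS) => y Ty Sd.
apply: le_trans Ty _.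
apply: le_trans (_ : (2 * `|T x| ^+ 2 + 1) * (e / (2 * `|T x| ^+ 2 + 1)) <= _).
  by apply: ler_pM => //; rewrite ?lerDl// mulr_ge0// exprn_ge0.
by rewrite mulrC divfK// gt_eqF.
Qed.

End Inversion.

Section DerivativeOfInverse.
Variables (R : realType) (E F G : normedModType R).

(** The derivative of A |-> A^-1 at an operator with inverse T, that is,
    the operator A |-> - T o A o T. *)
Definition clin_dinv (T : clin G F) : clin (clin F G) (clin G F) :=
  clin_comp ((- comp_op G G F) T) (flip (comp_op G F G) T).

Variables (S : E -> clin F G) (T : E -> clin G F).

(** With d = S (x + h) - S x, the remainder T (x + h) - T x + T x (S' h) T x
    equals - ((T (x + h) - T x) d T x + T x (d - S' h) T x); the first term is of
    order |h|^2 and the second is o(|h|). *)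
Lemma is_diff_inverse x (S' : clin E (clin F G)) :
  (\forall y \near x, inverse_at S T y) ->
  is_diff x S S' -> is_diff x T (clin_comp (clin_dinv (T x)) S').
Proof.
move=> nI dS; apply/is_diffP => e e0.
have Ix : inverse_at S T x by exact: nbhs_singleton nI.
set a := `|T x|; set c := `|S'| + 1.
have a0 : 0 <= a by exact: normr_ge0.
have c0 : 0 <= c by rewrite addr_ge0.
(* Chosen so that each of the two terms is at most e / 2 * |h|. *)
pose k1 := 2 * (a ^+ 2 + 1).
pose k2 := 2 * (2 * a ^+ 3 * c ^+ 2 + 1).
have k10 : 0 < k1 by rewrite mulr_gt0// ltr_wpDl// exprn_ge0.
have k20 : 0 < k2 by rewrite mulr_gt0// ltr_wpDl// !mulr_ge0// exprn_ge0.
have near_shiftx (P : E -> Prop) :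
    (\forall y \near x, P y) -> \forall h \near (0 : E), P (h + x).
  by rewrite (near_shift 0) subr0.
have e1 : 0 < e / k1 by rewrite divr_gt0.
have e2 : 0 < e / k2 by rewrite divr_gt0.
have N1 := near_shiftx _ (inverse_near_lipschitz nI (is_diff_continuous dS)).
have N2 := near_shiftx _ nI.
have N3 := (is_diffP S S' x).1 dS 1 ltr01.
have N4 := (is_diffP S S' x).1 dS _ e1.
have N5 := near0_norm_le E e2.
near=> h.
have Iy : inverse_at S T (h + x) by near: h.
have hT : `|T (h + x) - T x| <= 2 * `|T x| ^+ 2 * `|S (h + x) - S x| by near: h.
have hS1 : `|S (h + x) - S x - S' h| <= 1 * `|h| by near: h.
have hS : `|S (h + x) - S x - S' h| <= e / k1 * `|h| by near: h.
have hh : `|h| <= e / k2 by near: h.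
move: Iy hT hS1 hS; rewrite -/a; set y := h + x; set d := S y - S x.
move=> Iy hT hS1 hS.
have hd : `|d| <= c * `|h|.
  have : `|d| <= `|d - S' h| + `|S' h|.
    by apply: le_trans (ler_normD _ _); rewrite subrK.
  by have := le_clin_norm S' h; move: hS1; rewrite /c; lra.
have -> : T y - T x - clin_comp (clin_dinv (T x)) S' h =
    - (clin_comp (clin_comp (T y - T x) d) (T x) +
       clin_comp (clin_comp (T x) (d - S' h)) (T x)).
  apply: clinP => v.
  have E1 := inverse_sub v Ix Iy.
  have E2 := clin_sub (T x) (d (T x v)) (S' h (T x v)).
  have aux (p q r t : F) : p = - q -> - (q - r + (r - t)) = p - - t.
    by move=> ->; rewrite addrA subrK opprB opprK addrC.
  have := aux _ _ (T x (d (T x v))) (T x (S' h (T x v))) E1.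
  by rewrite -E2 => /esym.
rewrite normrN (le_trans (ler_normD _ _))//.
have B1 : `|clin_comp (clin_comp (T y - T x) d) (T x)| <= e / 2 * `|h|.
  apply: le_trans (clin_comp_norm _ _) _; rewrite -/a.
  apply: le_trans (_ : 2 * a ^+ 2 * `|d| * `|d| * a <= _).
    rewrite ler_wpM2r// (le_trans (clin_comp_norm _ _))// ler_wpM2r//.
  apply: le_trans (_ : 2 * a ^+ 2 * (c * `|h|) * (c * (e / k2)) * a <= _).
    have a2 : 0 <= 2 * a ^+ 2 by rewrite mulr_ge0// exprn_ge0.
    rewrite ler_wpM2r//; apply: ler_pM => //; first exact: mulr_ge0.
      by rewrite ler_wpM2l.
    by rewrite (le_trans hd)// ler_wpM2l.
  rewrite [leLHS](_ : _ = 2 * a ^+ 3 * c ^+ 2 * (e / k2) * `|h|); last by ring.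
  rewrite ler_wpM2r// mulrA ler_pdivrMr// /k2.
  have : 0 <= 2 * a ^+ 3 * c ^+ 2 by rewrite !mulr_ge0// exprn_ge0.
  by move: e0; nra.
have B2 : `|clin_comp (clin_comp (T x) (d - S' h)) (T x)| <= e / 2 * `|h|.
  apply: le_trans (clin_comp_norm _ _) _; rewrite -/a.
  apply: le_trans (_ : a * (e / k1 * `|h|) * a <= _).
    by rewrite ler_wpM2r// (le_trans (clin_comp_norm _ _))// ler_wpM2l.
  rewrite [leLHS](_ : _ = a ^+ 2 * (e / k1) * `|h|); last by ring.
  rewrite ler_wpM2r// mulrA ler_pdivrMr// /k1.
  have : 0 <= a ^+ 2 by rewrite exprn_ge0.
  by move: e0; nra.
by rewrite [e in leRHS]splitr mulrDl lerD.
Unshelve. all: by end_near. Qed.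

(** The derivative of T is a polynomial expression in T and S', so that T is C^(n+1)
    as soon as it is C^n. *)
Lemma Cn_inverse n (U : set E) : open U ->
  (forall x, U x -> inverse_at S T x) -> Cn n U S -> Cn n U T.
Proof.
move=> oU ST.
have nST x (Ux : U x) : \forall y \near x, inverse_at S T y.
  by apply: filterS (open_nbhs_nbhs (conj oU Ux)) => y; exact: ST.
elim: n => [|n IH].
  by move=> CS x Ux; apply: inverse_continuous (nST x Ux) _; exact: CS.
move=> CS; have CT := IH (CnS CS); case: CS => S' SS' CS'.
exists (fun x => clin_comp (clin_dinv (T x)) (S' x)) => [x Ux|].
  exact: is_diff_inverse (nST x Ux) (SS' x Ux).
apply: (Cn_bilinear (comp_op _ _ _)) => //.
by apply: (Cn_bilinear (comp_op _ _ _)); exact: Cn_clin_comp.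
Qed.

End DerivativeOfInverse.

(** * Smooth maps on open sets of normed spaces *)

Section SmoothOn.
Variable R : realType.
Implicit Types E F G H : normedModType R.

Lemma open_preimage E F (U : set E) (V : set F) (f : E -> F) :
  open U -> (forall x, U x -> {for x, continuous f}) -> open V ->
  open (U `&` f @^-1` V).
Proof.
move=> oU cf oV; rewrite openE => x [Ux Vfx]; apply: filterI.
  exact: open_nbhs_nbhs.
by apply: (cf x Ux); exact: open_nbhs_nbhs.
Qed.

Lemma smooth_on_continuous E F (U : set E) (f : E -> F) x :
  smooth_on U f -> U x -> {for x, continuous f}.
Proof. by move=> [_ Cf]; exact: Cf 0%N x. Qed.

Lemma smooth_on_local E F (U : set E) (f : E -> F) :
  (forall x, U x -> exists V, [/\ V x, V `<=` U & smooth_on V f]) ->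
  smooth_on U f.
Proof.
move=> fU; split=> [|n].
  rewrite openE => x /fU[V [Vx VU [oV _]]].
  by apply: filterS VU _; exact: open_nbhs_nbhs.
by apply: Cn_local => x /fU[V [Vx VU [oV Cf]]]; exists V.
Qed.

Lemma smooth_on_eq E F (U : set E) (f g : E -> F) :
  (forall x, U x -> f x = g x) -> smooth_on U f -> smooth_on U g.
Proof. by move=> fg [oU Cf]; split=> // n; exact: Cn_eq (Cf n). Qed.

Lemma smooth_on_sub E F (U V : set E) (f : E -> F) :
  open V -> V `<=` U -> smooth_on U f -> smooth_on V f.
Proof. by move=> oV VU [_ Cf]; split=> // n; exact: Cn_sub (Cf n). Qed.

Lemma smooth_on_comp E F G (U : set E) (V : set F) (f : E -> F) (g : F -> G) :
  smooth_on U f -> smooth_on V g -> smooth_on (U `&` f @^-1` V) (g \o f).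
Proof.
move=> sf [oV Cg]; have [oU Cf] := sf; split=> [|n].
  by apply: open_preimage => // x; exact: smooth_on_continuous.
apply: (@Cn_comp _ _ _ _ _ _ V) (Cg n) => [x []//|].
by apply: Cn_sub (Cf n) => x [].
Qed.

Lemma smooth_on_clin E F (U : set E) (T : clin E F) : open U -> smooth_on U T.
Proof. by move=> oU; split=> // n; exact: Cn_clin. Qed.

Lemma smooth_on_pair E F G (U : set E) (f : E -> F) (g : E -> G) :
  smooth_on U f -> smooth_on U g -> smooth_on U (fun x => (f x, g x)).
Proof. by move=> [oU Cf] [_ Cg]; split=> // n; exact: Cn_pair. Qed.

Lemma smooth_on_bilinear E F G H (B : clin F (clin G H)) (U : set E)
    (f : E -> F) (g : E -> G) :
  smooth_on U f -> smooth_on U g -> smooth_on U (fun x => B (f x) (g x)).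
Proof. by move=> [oU Cf] [_ Cg]; split=> // n; exact: Cn_bilinear. Qed.

Lemma smooth_on_inverse E F G (U : set E) (S : E -> clin F G)
    (T : E -> clin G F) :
  (forall x, U x -> inverse_at S T x) -> smooth_on U S -> smooth_on U T.
Proof. by move=> ST [oU CS]; split=> // n; apply: (Cn_inverse oU ST). Qed.

Lemma smooth_on_derivative E F (U : set E) (f : E -> F) :
  smooth_on U f -> smooth_on U (derivative f).
Proof. by move=> [oU Cf]; split=> // n; apply: Cn_derivative. Qed.

Lemma smooth_on_is_diff E F (U : set E) (f : E -> F) x :
  smooth_on U f -> U x -> is_diff x f (derivative f x).
Proof.
move=> [_ Cf] Ux; have [f' ff' _] := Cf 1%N.
exact: is_diff_derivative (ff' x Ux).
Qed.

End SmoothOn.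

(** * Smooth maps on atlases *)

Section SmoothFun.
Variable R : realType.
Implicit Types (A B C : atlas R) (F G H : normedModType R).

Lemma chart_inj A i (x y : A) :
  dom A i x -> dom A i y -> chart i x = chart i y -> x = y.
Proof. by move=> xi yi xy; rewrite -(chartK xi) xy chartK. Qed.

Lemma chart_imageI A i (U V : set A) :
  chart i @` (dom A i `&` (U `&` V)) =
  chart i @` (dom A i `&` U) `&` chart i @` (dom A i `&` V).
Proof.
apply/seteqP; split=> [_ [x [xi [Ux Vx]] <-]|_ [[x [xi Ux] <-] [y [yi Vy]]]].
  by split; exists x.
by move/(chart_inj yi xi) => yx; subst y; exists x.
Qed.

Lemma open_inI A (U V : set A) : open_in U -> open_in V -> open_in (U `&` V).
Proof. by move=> oU oV i; rewrite chart_imageI; exact: openI. Qed.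

Lemma smooth_fun_open A F (U : set A) (g : A -> F) :
  smooth_fun_on U g -> open_in U.
Proof. by move=> sg i; have [] := sg i. Qed.

Lemma smooth_fun_local A F (U : set A) (g : A -> F) :
  (forall x, U x -> exists V, [/\ V x, V `<=` U & smooth_fun_on V g]) ->
  smooth_fun_on U g.
Proof.
move=> gU i; apply: smooth_on_local => _ [x [xi Ux] <-].
have [V [Vx VU sg]] := gU x Ux.
exists (chart i @` (dom A i `&` V)); split=> //; first exact: imageP.
by move=> _ [y [yi Vy] <-]; exists y => //; split=> //; exact: VU.
Qed.

Lemma smooth_fun_eq A F (U : set A) (f g : A -> F) :
  (forall x, U x -> f x = g x) -> smooth_fun_on U f -> smooth_fun_on U g.
Proof.
move=> fg sf i; apply: smooth_on_eq (sf i) => _ [x [xi Ux] <-] /=.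
by rewrite chartK// fg.
Qed.

Lemma smooth_fun_sub A F (U V : set A) (g : A -> F) :
  open_in V -> V `<=` U -> smooth_fun_on U g -> smooth_fun_on V g.
Proof.
move=> oV VU sg i; apply: smooth_on_sub (oV i) _ (sg i).
by move=> _ [x [xi Vx] <-]; exists x => //; split=> //; exact: VU.
Qed.

Lemma smooth_fun_pair A F G (U : set A) (f : A -> F) (g : A -> G) :
  smooth_fun_on U f -> smooth_fun_on U g ->
  smooth_fun_on U (fun x => (f x, g x)).
Proof. by move=> sf sg i; exact: smooth_on_pair (sf i) (sg i). Qed.

Lemma smooth_fun_bilinear A F G H (B : clin F (clin G H)) (U : set A)
    (f : A -> F) (g : A -> G) :
  smooth_fun_on U f -> smooth_fun_on U g ->
  smooth_fun_on U (fun x => B (f x) (g x)).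
Proof. by move=> sf sg i; exact: smooth_on_bilinear (sf i) (sg i). Qed.

Lemma smooth_fun_inverse A F G (U : set A) (S : A -> clin F G)
    (T : A -> clin G F) :
  (forall x, U x -> cancel (S x) (T x) /\ cancel (T x) (S x)) ->
  smooth_fun_on U S -> smooth_fun_on U T.
Proof.
move=> ST sS i; apply: smooth_on_inverse (sS i) => _ [x [xi Ux] <-].
by rewrite /inverse_at /= chartK//; exact: ST.
Qed.

(** A map between atlases is smooth when its composite with each chart of the
    target is. *)
Lemma smooth_map_onP A B (U : set A) (f : A -> B) :
  smooth_map_on U f <->
  forall j, smooth_fun_on (U `&` f @^-1` dom B j) (chart j \o f).
Proof.
by split=> sf; [move=> j i; rewrite setIA|move=> i j; rewrite -setIA];
  exact: sf.
Qed.

Lemma smooth_fun_comp A B F (U : set A) (V : set B) (f : A -> B) (g : B -> F) :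
  smooth_map_on U f -> smooth_fun_on V g ->
  smooth_fun_on (U `&` f @^-1` V) (g \o f).
Proof.
move=> sf sg i; apply: smooth_on_local => _ [x [xi [Ux Vfx]] <-].
have [j fxj] := chart_cover (f x).
have s := smooth_on_comp (sf i j) (sg j).
(* Only this neighbourhood of the point is known to be open so far. *)
exists (chart i @` (dom A i `&` U `&` f @^-1` dom B j) `&`
  @local_rep _ A B f i j @^-1` (chart j @` (dom B j `&` V))); split.
- split; first exact: imageP.
  by rewrite /local_rep /= chartK//; exact: imageP.
- move=> _ [[y [[yi Uy] fyj] <-]]; rewrite /local_rep /= chartK//.
  case=> z [zj Vz] /(chart_inj zj fyj) zE.
  by exists y => //; split=> //; split=> //=; rewrite -zE.
- apply: smooth_on_eq s => _ [[y [[yi Uy] fyj] <-]] _.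
  by rewrite /local_rep /= chartK// chartK.
Qed.

Lemma smooth_map_comp A B C (U : set A) (V : set B) (f : A -> B) (g : B -> C) :
  smooth_map_on U f -> smooth_map_on V g ->
  smooth_map_on (U `&` f @^-1` V) (g \o f).
Proof.
move=> sf /smooth_map_onP sg; apply/smooth_map_onP => k.
by have := smooth_fun_comp sf (sg k); rewrite setIA.
Qed.

Lemma smooth_fun_comp_on A F G (U : set A) (V : set F) (f : A -> F)
    (g : F -> G) :
  smooth_fun_on U f -> smooth_on V g ->
  smooth_fun_on (U `&` f @^-1` V) (g \o f).
Proof.
move=> sf sg i; have s := smooth_on_comp (sf i) sg.
suff -> : chart i @` (dom A i `&` (U `&` f @^-1` V)) =
  chart i @` (dom A i `&` U) `&` (f \o chartV i) @^-1` V by [].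
apply/seteqP; split=> [_ [x [xi [Ux Vx]] <-]|_ [[x [xi Ux] <-]]] /=.
  by split; [exists x|rewrite chartK].
by rewrite chartK// => Vx; exists x.
Qed.

Lemma smooth_map_pair A B (F : completeNormedModType R) (U : set A)
    (f : A -> B) (g : A -> F) :
  smooth_map_on U f -> smooth_fun_on U g ->
  @smooth_map_on R A (prod_atlas B F) U (fun x => (f x, g x)).
Proof.
move=> /smooth_map_onP sf sg; apply/smooth_map_onP => j.
apply: (smooth_fun_pair (sf j)).
by apply: smooth_fun_sub sg => [|x []//]; exact: smooth_fun_open (sf j).
Qed.

Lemma smooth_map_sub A B (U V : set A) (f : A -> B) :
  open_in V -> V `<=` U -> smooth_map_on U f -> smooth_map_on V f.
Proof.
move=> oV VU /smooth_map_onP sf; apply/smooth_map_onP => j.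
have sub x : (V `&` f @^-1` dom B j) x -> (U `&` f @^-1` dom B j) x.
  by move=> [/VU].
have -> : V `&` f @^-1` dom B j = V `&` (U `&` f @^-1` dom B j).
  apply/seteqP; split=> x; last by case=> ? [].
  by move=> Vx; have := sub x Vx; case: Vx.
apply: smooth_fun_sub (sf j) => [|x []//].
by apply: open_inI => //; exact: smooth_fun_open (sf j).
Qed.

Lemma smooth_map_local A B (U : set A) (f : A -> B) :
  (forall x, U x -> exists V, [/\ V x, V `<=` U & smooth_map_on V f]) ->
  smooth_map_on U f.
Proof.
move=> fU; apply/smooth_map_onP => j; apply: smooth_fun_local => x [Ux fxj].
have [V [Vx VU /smooth_map_onP sf]] := fU x Ux.
by exists (V `&` f @^-1` dom B j); split=> // y [/VU].
Qed.

Lemma smooth_map_eq A B (U : set A) (f g : A -> B) :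
  (forall x, U x -> f x = g x) -> smooth_map_on U f -> smooth_map_on U g.
Proof.
move=> fg /smooth_map_onP sf; apply/smooth_map_onP => j.
have -> : U `&` g @^-1` dom B j = U `&` f @^-1` dom B j.
  by apply/seteqP; split=> x [Ux] /=; rewrite fg.
by apply: smooth_fun_eq (sf j) => x [Ux _] /=; rewrite fg.
Qed.

Lemma prod_chart_image A (F : completeNormedModType R) (i : chart_idx A)
    (U : set A) :
  chart (a := prod_atlas A F) i @` (dom (prod_atlas A F) i `&` [set p | U p.1]) =
  fst @^-1` (chart i @` (dom A i `&` U)).
Proof.
apply/seteqP; split=> [_ [p [pi Up] <-]|[y v] /= [x [xi Ux] <-]].
  by exists p.1.
by exists (x, v).
Qed.

Lemma smooth_fun_fst A (F : completeNormedModType R) G (U : set A) (g : A -> G) :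
  smooth_fun_on U g ->
  @smooth_fun_on R (prod_atlas A F) G [set p | U p.1] (fun p => g p.1).
Proof.
move=> sg i; rewrite (@prod_chart_image A F i U).
pose E := @model R A i.
have := smooth_on_comp (smooth_on_clin (clin_fst E F) openT) (sg i).
by rewrite setTI.
Qed.

Lemma smooth_fun_snd A (F : completeNormedModType R) (U : set A) :
  open_in U -> @smooth_fun_on R (prod_atlas A F) F [set p | U p.1] snd.
Proof.
move=> oU i; rewrite (@prod_chart_image A F i U).
pose E := @model R A i.
apply: (smooth_on_clin (clin_snd E F)).
rewrite -[X in open X]setTI; apply: open_preimage (oU i); first exact: openT.
by move=> x _; exact: (@clin_continuous _ _ _ (clin_fst E F)).
Qed.

End SmoothFun.

Section ManifoldCharts.
Variables (R : realType) (A : manifold R).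

Lemma smooth_chart (i : chart_idx A) : smooth_fun_on (dom A i) (chart i).
Proof. move=> j; exact: manifold_smooth. Qed.

Lemma smooth_map_id : smooth_map (id : A -> A).
Proof. by move=> i j; rewrite setIT; exact: manifold_smooth. Qed.

End ManifoldCharts.

(** * Tangent vectors and tangent maps *)

Lemma diff_derivative (R : realType) (E F : normedModType R) (f : E -> F) x
    (T : clin E F) v :
  is_diff x f T -> 'd f x v = derivative f x v.
Proof. by move=> fT; rewrite (derivativeE fT) diff_val. Qed.

Section ChainRule.
Variable R : realType.
Implicit Types A B C : atlas R.

Lemma smooth_map_is_diff A B (f : A -> B) i j x :
  smooth_map f -> dom A i x -> dom B j (f x) ->
  is_diff (chart i x) (@local_rep _ A B f i j)
    (derivative (@local_rep _ A B f i j) (chart i x)).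
Proof.
by move=> sf xi fxj; apply: smooth_on_is_diff (sf i j) _; exact: imageP.
Qed.

Lemma smooth_map_near A B (f : A -> B) i j x :
  smooth_map f -> dom A i x -> dom B j (f x) ->
  \forall y \near chart i x, dom A i (chartV i y) /\ dom B j (f (chartV i y)).
Proof.
move=> sf xi fxj; have [os _] := sf i j.
have : nbhs (chart i x) (chart i @` (dom A i `&` setT `&` f @^-1` dom B j)).
  by apply: open_nbhs_nbhs; split => //; exact: imageP.
by apply: filterS => _ [y [[yi _] fyj] <-]; rewrite chartK.
Qed.

Lemma derivative_local_rep_comp A B C (f : A -> B) (g : B -> C) i j k x v :
  smooth_map f -> smooth_map g ->
  dom A i x -> dom B j (f x) -> dom C k (g (f x)) ->
  derivative (@local_rep _ A C (g \o f) i k) (chart i x) v =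
  derivative (@local_rep _ B C g j k) (chart j (f x))
    (derivative (@local_rep _ A B f i j) (chart i x) v).
Proof.
move=> sf sg xi fxj gfxk; pose p := chart i x.
have df := smooth_map_is_diff sf xi fxj.
have dg := smooth_map_is_diff sg fxj gfxk.
set Df := derivative (local_rep f _) _ in df *.
set Dg := derivative (local_rep g _) _ in dg *.
suff /derivativeE -> :
    is_diff p (@local_rep _ A C (g \o f) i k) (clin_comp Dg Df).
  by [].
have dg' : is_diff (@local_rep _ A B f i j p) (@local_rep _ B C g j k) Dg.
  by rewrite /local_rep /p /= chartK.
apply: (near_is_diff (T := clin_comp Dg Df) _ (is_diff_comp df dg')).
apply: filterS (smooth_map_near sf xi fxj) => y [yi fyj].
by rewrite /local_rep /= chartK.
Qed.

End ChainRule.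

Section TangentCoordinates.
Variables (R : realType) (A : manifold R).
Implicit Types i j : chart_idx A.

(** The derivative at x of the change of charts from i to j, regarded as the
    local representative of the identity map, so that the chain rule for local
    representatives covers changes of charts. *)
Definition dtrans i j (x : A) : clin (model i) (model j) :=
  derivative (@local_rep _ A A id i j) (chart i x).

Lemma diff_dtrans i j x v : dom A i x -> dom A j x ->
  'd (chart j \o chartV i : model i -> model j) (chart i x) v = dtrans i j x v.
Proof.
move=> xi xj; apply: diff_derivative.
exact: (smooth_map_is_diff (@smooth_map_id _ A) xi xj).
Qed.

Lemma dtrans_id i x v : dom A i x -> dtrans i i x v = v.
Proof.
move=> xi; suff /derivativeE : is_diff (chart i x)
  (@local_rep _ A A id i i) (clin_id (model i)) by rewrite /dtrans => ->.
apply: near_is_diff (is_diff_clin (clin_id (model i)) (chart i x)).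
have : nbhs (chart i x) (chart i @` (dom A i `&` dom A i)).
  apply: open_nbhs_nbhs; split; last exact: imageP.
  by have [] := @manifold_smooth _ A i i.
by apply: filterS => _ [y [yi _] <-]; rewrite /local_rep /= chartK.
Qed.

Lemma tcoord_tvec i j x v : dom A i x -> dom A j x ->
  tcoord j (tvec (i:=i) x v) = dtrans i j x v.
Proof.
move=> xi xj; rewrite -diff_dtrans// /tvec; case: pselect => // xi'.
exact: tcoordE.
Qed.

Lemma tcoord_tvec_id i x v : dom A i x -> tcoord i (tvec (i:=i) x v) = v.
Proof. by move=> xi; rewrite tcoord_tvec// dtrans_id. Qed.

Lemma tvec_tcoord i (X : tangent A) : dom A i (base X) ->
  tvec (base X) (tcoord i X) = X.
Proof.
by move=> xi; have := tangent_chartK xi; rewrite /= /tangent_chartV /= chartK.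
Qed.

Lemma tcoord_dtrans i j (X : tangent A) : dom A i (base X) -> dom A j (base X) ->
  tcoord j X = dtrans i j (base X) (tcoord i X).
Proof. by move=> xi xj; rewrite -{1}(tvec_tcoord xi) tcoord_tvec. Qed.

Lemma tvec_dtrans i j x v : dom A i x -> dom A j x ->
  tvec (i:=j) x (dtrans i j x v) = tvec (i:=i) x v.
Proof.
move=> xi xj; rewrite -tcoord_tvec//.
have b := base_tvec x v.
have xj' : dom A j (base (tvec (i:=i) x v)) by rewrite b.
by have := tvec_tcoord xj'; rewrite {1}b.
Qed.

End TangentCoordinates.

Section TangentMaps.
Variables (R : realType) (A B : manifold R) (f : A -> B).
Hypothesis sf : smooth_map f.

Lemma base_tangent_map (X : tangent A) : base (tangent_map f X) = f (base X).
Proof. exact: base_tvec. Qed.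

(** The tangent map may be computed in any pair of charts, not only the chosen
    ones. *)
Lemma tangent_map_chart i j (X : tangent A) :
  dom A i (base X) -> dom B j (f (base X)) ->
  tangent_map f X = tvec (f (base X))
    (derivative (@local_rep _ A B f i j) (chart i (base X)) (tcoord i X)).
Proof.
move=> xi fxj; rewrite /tangent_map; set x := base X.
set i0 := chart_at x; set j0 := chart_at (f x).
have xi0 : dom A i0 x by exact: chart_atP.
have fxj0 : dom B j0 (f x) by exact: chart_atP.
rewrite (diff_derivative _ (smooth_map_is_diff sf xi0 fxj0)).
rewrite -(tvec_dtrans _ fxj0 fxj) (tcoord_dtrans xi xi0) -/x.
(* Changes of charts on both sides are absorbed by the chain rule. *)
have sidA := @smooth_map_id _ A; have sidB := @smooth_map_id _ B.
rewrite /dtrans -(derivative_local_rep_comp _ sidA sf xi xi0 fxj0).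
by rewrite -(derivative_local_rep_comp _ sf sidB xi fxj0 fxj).
Qed.

Lemma tangent_map_tvec i j x v : dom A i x -> dom B j (f x) ->
  tangent_map f (tvec (i:=i) x v) =
  tvec (f x) (derivative (@local_rep _ A B f i j) (chart i x) v).
Proof.
move=> xi fxj; have b := base_tvec x v.
rewrite (@tangent_map_chart i j) ?b//.
by rewrite tcoord_tvec_id.
Qed.

Lemma tangent_map_velocity (c : R -> A) t :
  (\forall s \near t, dom A (chart_at (c t)) (c s)) ->
  differentiable (chart (chart_at (c t)) \o c : R -> model (chart_at (c t))) t ->
  tangent_map f (velocity c t) = velocity (f \o c) t.
Proof.
set i := chart_at (c t) => cdom dc.
have xi : dom A i (c t) by exact: chart_atP.
pose j := chart_at (f (c t)).
have fxj : dom B j (f (c t)) by exact: chart_atP.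
rewrite /velocity -/i -/j (tangent_map_tvec _ xi fxj); congr tvec.
have dfi := smooth_map_is_diff sf xi fxj.
set D := derivative _ _ in dfi *.
set u : R -> model i := chart i \o c in dc *.
have dfi' : is_diff (u t) (@local_rep _ A B f i j) D by [].
have dfu := is_diff_comp (differentiableP dc) dfi'.
have ld : linear ('d u t : R -> model i) by move=> a p q; rewrite linearP.
pose T : clin R (model i) := CLin ld (diff_continuous dc).
have near_eq : \forall s \near t,
    (@local_rep _ A B f i j \o u) s = (chart j \o (f \o c)) s.
  by apply: filterS cdom => s si; rewrite /local_rep /u /= chartK.
have dj : is_diff t (chart j \o (f \o c) : R -> model j) (clin_comp D T).
  exact: (near_is_diff (T := clin_comp D T) near_eq dfu).
case: dj => djd djE.
by rewrite !derive1E' // djE.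
Qed.

End TangentMaps.

(** * Operator families and vector bundles *)

Section OperatorFamilies.
Variables (R : realType) (A : atlas R) (F G : normedModType R).

(** Smoothness of an operator family is local: the operators are determined by
    their values, hence agree wherever they are defined. *)
Lemma smooth_operator_family_local (U : set A) (T : A -> F -> G) :
  (forall x, U x -> exists V, [/\ V x, V `<=` U & smooth_operator_family V T]) ->
  smooth_operator_family U T.
Proof.
move=> TU.
have [T' T'E] : {T' : A -> clin F G & forall x, U x -> forall v, T' x v = T x v}.
  have /choice[T' T'E] : forall x, exists S : clin F G,
      U x -> forall v, S v = T x v.
    move=> x; have [Ux|nUx] := pselect (U x); last by exists 0.
    have [V [Vx _ [S [SE _]]]] := TU x Ux.
    by exists (S x) => _; exact: SE.
  by exists T'.
exists T'; split=> //; apply: smooth_fun_local => x Ux.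
have [V [Vx VU [S [SE sS]]]] := TU x Ux.
exists V; split=> //; apply: smooth_fun_eq sS => y Vy.
by apply: clinP => v; rewrite SE// T'E//; exact: VU.
Qed.

End OperatorFamilies.

Section BundleFacts.
Variables (R : realType) (D Z : manifold R) (P : vector_bundle D Z).

Lemma trivialization (a : triv_idx P) : is_trivialization a.
Proof. by have [_ tP _] := vb_axioms P; exact: tP. Qed.

Lemma smooth_proj : smooth_map (proj P).
Proof. by have [] := vb_axioms P. Qed.

Lemma proj_trivV (a : triv_idx P) z v : tdom P a z -> proj P (trivV a z v) = z.
Proof.
by move=> za; have [_ VK _ _ _] := trivialization a; have [] := VK z v za.
Qed.

Lemma trivK (a : triv_idx P) e :
  tdom P a (proj P e) -> trivV a (proj P e) (triv a e) = e.
Proof. by have [_ _ K _ _] := trivialization a; exact: K. Qed.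

Lemma triv_atP z : tdom P (triv_at P z) z.
Proof. by rewrite /triv_at; case: cid. Qed.

Lemma smooth_map_fst (B : atlas R) (F : completeNormedModType R) (U : set D)
    (f : D -> B) :
  smooth_map_on U f ->
  @smooth_map_on R (prod_atlas D F) B [set p | U p.1] (fun p => f p.1).
Proof.
move=> /smooth_map_onP sf; apply/smooth_map_onP => j.
have := @smooth_fun_fst _ _ F _ _ _ (sf j); exact.
Qed.

Section SmoothFromFamilies.
Variable K : tangent_atlas D -> D.
Hypothesis projK : forall X, proj P (K X) = proj P (base X).
Hypothesis famK : forall i (a : triv_idx P),
  smooth_operator_family (dom D i `&` proj P @^-1` tdom P a)
    (fun e (v : model i) => triv a (K (tvec e v))).

(** K is read in the product of D with a model space, whose charts induce the
    same local representatives as those of the tangent manifold. *)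
Lemma smooth_map_tvec i :
  @smooth_map_on R (prod_atlas D (model i)) D [set p | dom D i p.1]
    (fun p => K (tvec p.1 p.2)).
Proof.
apply: smooth_map_local => p pi.
set a := triv_at P (proj P p.1).
have [T' [T'E sT']] := famK i a.
set U := _ `&` _ in T'E sT'.
pose m (q : prod_atlas D (model i)) : prod_atlas Z (fib a) :=
  (proj P q.1, T' q.1 q.2).
pose U1 : set (prod_atlas D (model i)) := [set q | U q.1].
have oU : open_in U := smooth_fun_open sT'.
have sm : smooth_map_on U1 m.
  apply: smooth_map_pair.
    apply: (@smooth_map_fst Z (model i) U (proj P)).
    exact: smooth_map_sub smooth_proj.
  apply: (smooth_fun_bilinear (clin_id _)) => /=.
    exact: (@smooth_fun_fst _ D (model i) _ U T' sT').
  exact: (@smooth_fun_snd _ D (model i) U oU).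
have [_ _ _ _ sV] := trivialization a.
exists (U1 `&` m @^-1` [set q | tdom P a q.1]); split.
- by split; [split=> //|]; exact: triv_atP.
- by move=> q [[]].
- apply: smooth_map_eq (smooth_map_comp sm sV) => q [[qi qa] _] /=.
  rewrite T'E//; set X := tvec _ _.
  have -> : proj P q.1 = proj P (K X) by rewrite projK base_tvec.
  by rewrite trivK// projK base_tvec.
Qed.

(** A map from the tangent bundle to P that is linear on fibres is smooth as soon
    as its operators depend smoothly on the base point. *)
Lemma smooth_map_of_families : smooth_map K.
Proof.
move=> i l; have := @smooth_map_tvec i i l.
set W := (X in smooth_on X _); set W' := (X in _ -> smooth_on X _).
suff -> : W' = W by [].
apply/seteqP; split=> [_ [X [[Xi _] KX] <-]|_ [[e v] [[/= ei _] KX] <-]].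
  exists (@base _ D X, @tcoord _ D i X) => //; split=> //.
  by rewrite /preimage /= tvec_tcoord.
exists (@tvec _ D i e v).
  by split=> //; split=> //; rewrite /= /tangent_dom /= base_tvec.
by rewrite /= /tangent_chart base_tvec tcoord_tvec_id.
Qed.

End SmoothFromFamilies.

Lemma fiber_line0 xi eta : fiber_line P xi eta 0 = xi.
Proof. by rewrite /fiber_line scale0r addr0 trivK//; exact: triv_atP. Qed.

(** For t near 0 the path t |-> xi + t eta stays in each chart around xi, and it
    is differentiable there at 0. *)
Lemma fiber_line_diff xi eta (i : chart_idx D) : dom D i xi ->
  (\forall t \near (0 : R), dom D i (fiber_line P xi eta t)) /\
  differentiable (chart i \o fiber_line P xi eta : R -> model i) 0.
Proof.
move=> xii; set z := proj P xi; set a := triv_at P z.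
have za : tdom P a z := triv_atP z.
have [k zk] := chart_cover z.
have [_ _ _ _ sV] := trivialization a.
pose phi (p : prod_atlas Z (fib a)) : D := trivV a p.1 p.2.
pose f : model k * fib a -> model i :=
  @local_rep _ (prod_atlas Z (fib a)) D phi k i.
have [oW CW] := sV k i.
set W := _ @` _ in oW CW.
pose u (t : R) : model k * fib a := (chart k z, triv a xi + t *: triv a eta).
have du : differentiable u 0.
  apply: differentiable_pair; first exact: differentiable_cst.
  apply: differentiableD; first exact: differentiable_cst.
  by apply: differentiableZl; have [] := is_diff_id (0 : R).
have Wu : W (u 0).
  exists (z, triv a xi); last by rewrite /u scale0r addr0.
  by split=> //=; rewrite trivK.
have nW : \forall t \near (0 : R), W (u t).
  by apply: (differentiable_continuous du); exact: open_nbhs_nbhs.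
split.
  apply: filterS nW => t [[y v] [[/= yk ya] yi] [/(chart_inj yk zk) /= yz vE]].
  by move: yi; rewrite /phi /fiber_line /preimage /= -/z -/a yz vE.
have [f' ff' _] := CW 1%N.
have df : differentiable f (u 0) by have [] := ff' (u 0) Wu.
have -> : chart i \o fiber_line P xi eta = f \o u.
  by apply/funext => t; rewrite /f /local_rep /phi /u /= /prod_chartV /= chartK.
exact: differentiable_comp.
Qed.

End BundleFacts.

(** * Pulling back a connection map *)

Section Pullback.
Variables (R : realType) (D Z D' Z' : manifold R).
Variables (P : vector_bundle D Z) (P' : vector_bundle D' Z').
Variables (delta : D -> D') (zeta : Z -> Z').
Hypothesis hmor : vb_morphism P P' delta zeta.
Hypothesis hiso : fiberwise_iso P P' delta zeta.

Let sdelta : smooth_map delta. Proof. by case: hmor. Qed.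
Let proj_delta e : proj P' (delta e) = zeta (proj P e).
Proof. by case: hmor. Qed.

Lemma delta_fiber_inj e1 e2 :
  proj P e1 = proj P e2 -> delta e1 = delta e2 -> e1 = e2.
Proof.
move=> p12 d12.
have [a e1a] := triv_cover P (proj P e1).
have [b e1b] := triv_cover P' (zeta (proj P e1)).
have e2a : tdom P a (proj P e2) by rewrite -p12.
have [S [T [SK _ SE]]] := hiso e1a e1b.
rewrite -(trivK e1a) -(trivK e2a) -p12; congr trivV.
by apply: (can_inj SK); rewrite -!SE trivK// p12 trivK// d12.
Qed.

Lemma delta_fiber_surj z e' :
  proj P' e' = zeta z -> exists e, proj P e = z /\ delta e = e'.
Proof.
move=> pe'; have [a za] := triv_cover P z.
have [b zb] := triv_cover P' (zeta z).
have [S [T [_ TK SE]]] := hiso za zb.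
exists (trivV a z (T (triv b e'))).
split; first exact: proj_trivV.
set e := trivV _ _ _.
have pe : proj P' (delta e) = zeta z by rewrite proj_delta proj_trivV.
have zb1 : tdom P' b (proj P' (delta e)) by rewrite pe.
have zb2 : tdom P' b (proj P' e') by rewrite pe'.
by rewrite -(trivK zb1) pe SE TK -pe' trivK.
Qed.

(** The inverses of the fibre isomorphisms, in trivializations, depend smoothly
    on the base point. *)
Lemma fiber_inverse (a : triv_idx P) (b : triv_idx P') :
  exists Q : Z -> clin (fib b) (fib a),
    (forall e, tdom P a (proj P e) -> tdom P' b (zeta (proj P e)) ->
       Q (proj P e) (triv b (delta e)) = triv a e) /\
    smooth_fun_on (tdom P a `&` zeta @^-1` tdom P' b) Q.
Proof.
have [_ _ _ /(_ a b)[S [SE sS]]] := hmor.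
have /choice[Q QP] : forall z, exists T : clin (fib b) (fib a),
    (tdom P a `&` zeta @^-1` tdom P' b) z -> cancel (S z) T /\ cancel T (S z).
  move=> z; have [Uz|nUz] := pselect ((tdom P a `&` zeta @^-1` tdom P' b) z);
    last by exists 0.
  have [S1 [T [SK TK S1E]]] := hiso Uz.1 Uz.2.
  have <- : S1 = S z by apply: clinP => v; rewrite SE// S1E.
  by exists T.
exists Q; split; last exact: smooth_fun_inverse QP sS.
move=> e ea eb; have Uz : (tdom P a `&` zeta @^-1` tdom P' b) (proj P e) by [].
by rewrite -{2}(trivK ea) -SE// (QP _ Uz).1.
Qed.

Section Family.
Variables (K' : tangent_atlas D' -> D') (K : tangent_atlas D -> D).
Hypothesis mK' : vb_morphism (tangent_bundle D') P' K' (proj P').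
Hypothesis projK : forall X : tangent D, proj P (K X) = proj P (base X).
Hypothesis deltaK : forall X : tangent D, delta (K X) = K' (tangent_map delta X).

(** Around a point, with j and b fixed there, the operator of K at e is the
    product of the inverse of the fibre isomorphism at proj e, of the operator of
    K' at delta e, and of the derivative of delta at e. *)
Lemma pullback_family i (a : triv_idx P) :
  smooth_operator_family (dom D i `&` proj P @^-1` tdom P a)
    (fun e (v : model i) => triv a (K (tvec e v))).
Proof.
apply: smooth_operator_family_local => e0 [e0i e0a].
have [j e0j] := chart_cover (delta e0).
have [b e0b] := triv_cover P' (zeta (proj P e0)).
have [Q [QE sQ]] := fiber_inverse a b.
have [_ _ _ /(_ j b)[T1 [T1E sT1]]] := mK'.
have s1 := smooth_fun_comp (@smooth_proj _ _ _ P) sQ.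
have s2 := smooth_fun_comp sdelta sT1.
have s3 := smooth_fun_comp_on (@smooth_chart _ D i)
  (smooth_on_derivative (sdelta i j)).
set U1 := (X in smooth_fun_on X _) in s1.
set U2 := (X in smooth_fun_on X _) in s2.
set U3 := (X in smooth_fun_on X _) in s3.
have oV : open_in (U1 `&` U2 `&` U3).
  by apply: open_inI; [apply: open_inI|]; apply: smooth_fun_open; eassumption.
exists (U1 `&` U2 `&` U3); split.
- split; last by split=> //; exact: imageP.
  by split; split=> //; split=> //=; rewrite proj_delta.
- by move=> e [[[_ [ea _]] _] [ei _]].
exists (fun e => clin_comp (Q (proj P e)) (clin_comp (T1 (delta e))
  (derivative (@local_rep _ D D' delta i j) (chart i e)))); split.
  move=> e [[[_ [ea eb]] [_ [ej eb']]] [ei _]] v /=.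
  rewrite T1E//= -(tangent_map_tvec sdelta v ei ej) -deltaK.
  set X := tvec e v.
  have pX : proj P (K X) = proj P e by rewrite projK base_tvec.
  by rewrite -pX QE// pX.
apply: (smooth_fun_bilinear (comp_op _ _ _)).
  by apply: smooth_fun_sub s1 => // e [[]].
apply: (smooth_fun_bilinear (comp_op _ _ _)).
  by apply: smooth_fun_sub s2 => // e [[]].
by apply: smooth_fun_sub s3 => // e [].
Qed.

End Family.

(** The map delta is linear on fibres, hence maps the lines of D to those of D'. *)
Lemma delta_fiber_line xi eta : proj P xi = proj P eta ->
  delta \o fiber_line P xi eta = fiber_line P' (delta xi) (delta eta).
Proof.
move=> pxe; apply/funext => t; rewrite /= /fiber_line proj_delta.
set z := proj P xi; set a := triv_at P z; set b := triv_at P' (zeta z).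
have za : tdom P a z := triv_atP P z.
have zb : tdom P' b (zeta z) := triv_atP P' (zeta z).
have [S [_ [_ _ SE]]] := hiso za zb.
set w := triv a xi + _.
have pw : proj P' (delta (trivV a z w)) = zeta z.
  by rewrite proj_delta proj_trivV.
have zw : tdom P' b (proj P' (delta (trivV a z w))) by rewrite pw.
rewrite -(trivK zw) pw SE; congr trivV.
have tS e : proj P e = z -> triv b (delta e) = S (triv a e).
  by move=> pe; rewrite -SE -pe trivK// pe.
rewrite !tS// addrC [w]addrC; exact: clin_linear.
Qed.

Lemma tangent_map_vertical_lift xi eta : proj P xi = proj P eta ->
  tangent_map delta (vertical_lift P xi eta) =
  vertical_lift P' (delta xi) (delta eta).
Proof.
move=> pxe; rewrite /vertical_lift -delta_fiber_line//.
have [nd dd] := @fiber_line_diff _ _ _ P xi eta _ (chart_atP xi).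
by apply: tangent_map_velocity; rewrite ?fiber_line0.
Qed.

End Pullback.

Theorem proposition2p8 (R : realType) (D Z D' Z' : manifold R)
    (Pi : vector_bundle D Z) (Pi' : vector_bundle D' Z')
    (delta : D -> D') (zeta : Z -> Z')
    (hmor : vb_morphism Pi Pi' delta zeta)
    (hiso : fiberwise_iso Pi Pi' delta zeta)
    (K' : tangent_atlas D' -> D') (hK' : connection_map Pi' K') :
  exists! K : tangent_atlas D -> D,
    connection_map Pi K /\
    delta \o K = K' \o (tangent_map delta : tangent_atlas D -> tangent_atlas D').
Proof.
have [_ projK' morK' vertK'] := hK'.
have [sdelta _ proj_delta _] := hmor.
have /choice[K KE] : forall X : tangent D, exists e,
    proj Pi e = proj Pi (base X) /\ delta e = K' (tangent_map delta X).
  move=> X; apply: (delta_fiber_surj hmor hiso).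
  by rewrite projK' /= base_tangent_map proj_delta.
have projK X : proj Pi (K X) = proj Pi (base X) by have [] := KE X.
have deltaK X : delta (K X) = K' (tangent_map delta X) by have [] := KE X.
have famK := pullback_family hmor hiso morK' projK deltaK.
have sK := smooth_map_of_families projK famK.
exists K; split=> [|L [[_ projL _ _] deltaL]]; last first.
  apply/funext => X.
  apply: (delta_fiber_inj hiso); first by rewrite projK projL.
  by rewrite deltaK; move/(congr1 (fun f => f X)): deltaL => /= ->.
split; last by apply/funext => X; exact: deltaK.
split=> //; first by split=> //; exact: smooth_proj.
move=> xi eta pxe; apply: (delta_fiber_inj hiso).
  by rewrite projK /= base_tvec fiber_line0.
rewrite deltaK (tangent_map_vertical_lift hmor hiso pxe) vertK'//.
by rewrite !proj_delta pxe.
Qed.
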